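(* Let $(G_n)_{n\ge 1}$ be a sequence of connected graphs with vertex sets $V_n$ of size $n$, and let $d_n(x)$ be the degree of vertex $x$ in $G_n$. Consider the noisy voter models $\mathrm{NVM}(V_n,P_n,p_n)$ where $P_n$ is the transition matrix of the (simple) random walk on $G_n$, $p_n\in(0,1]$, and $(p_n)$ is non-increasing. If $$\left(\frac{\max_{x\in V_n}d_n(x)}{\sqrt{\sum_{x\in V_n}d_n(x)^2}}\right)^3\frac{n}{p_n}\to0\quad\text{as }n\to\infty,$$ then $W_n$ converges in distribution to $\mathcal N(0,1)$ as $n\to\infty$.
   Context: Noisy voter model: let $V$ be a finite set, $P$ an irreducible transition (stochastic) matrix on $V$ with stationary distribution $\pi$, and $p\in(0,1]$. $\mathrm{NVM}(V,P,p)$ is the discrete-time Markov chain on $\{0,1\}^V$ which at each step chooses a vertex $x\in V$ uniformly at random and updates only its opinion: with probability $p$ the opinion of $x$ is replaced by a fair coin flip in $\{0,1\}$; otherwise, with probability $1-p$, a vertex $y$ is chosen with probability $P(x,y)$ and the opinion of $x$ is replaced by the current opinion of $y$. For $p>0$ it has a unique stationary distribution $\Gamma$. With $\xi\sim\Gamma$, set $S=\sum_{x\in V}\pi(x)\xi(x)$, $\sigma^2=\mathrm{Var}(S)$ and $W=(S-\mathbb E(S))/\sigma$. A subscript $n$ (as in $W_n$) denotes these quantities for $\mathrm{NVM}(V_n,P_n,p_n)$. The random walk on a graph moves to a uniformly chosen neighbour at each step. *)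

(* Defs.v *)
From HB Require Import structures.
From mathcomp Require Import all_boot all_order all_algebra.
From mathcomp Require Import all_classical all_reals all_analysis.

Set Implicit Arguments.
Unset Strict Implicit.
Unset Printing Implicit Defensive.

Import Order.TTheory GRing.Theory Num.Theory.
Import numFieldNormedType.Exports.

Local Open Scope classical_set_scope.
Local Open Scope ring_scope.

Definition connected_graph (V : finType) (e : rel V) : Prop :=
  [/\ symmetric e, irreflexive e & forall x y, connect e x y].

Definition degree (V : finType) (e : rel V) (x : V) : nat := #|e x|.

(* A connected graph has an isolated vertex only if it is a single vertex; the
   walk then stays put, so that the matrix is stochastic in that case too. *)
Definition random_walk (R : realType) (V : finType) (e : rel V) (x y : V) : R :=
  if degree e x == 0%N then (x == y)%:R else (e x y)%:R / (degree e x)%:R.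

Definition stationary_distribution (R : realType) (T : finType)
    (Q : T -> T -> R) (mu : T -> R) : Prop :=
  [/\ forall x, 0 <= mu x,
      \sum_x mu x = 1 &
      forall y, \sum_x mu x * Q x y = mu y].

(* {0,1}^V, carrying the discrete sigma-algebra. *)
Definition config (V : finType) : Type := {ffun V -> bool}.

HB.instance Definition _ (V : finType) := Finite.on (config V).
HB.instance Definition _ (V : finType) :=
  isPointed.Build (config V) [ffun=> false].
HB.instance Definition _ (V : finType) :=
  @isMeasurable.Build default_measure_display (config V)
    discrete_measurable discrete_measurable0
    discrete_measurableC discrete_measurableU.

Definition update (V : finType) (xi : config V) (x : V) (b : bool) : config V :=
  [ffun z => if z == x then b else xi z].

(* Probability of moving from xi to eta in one step of NVM(V, P, p). *)
Definition nvm (R : realType) (V : finType) (P : V -> V -> R) (p : R)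
    (xi eta : config V) : R :=
  #|V|%:R^-1 * \sum_(x : V)
    (p * (\sum_(b : bool) 2^-1 * (eta == update xi x b)%:R)
     + (1 - p) * (\sum_(y : V) P x y * (eta == update xi x (xi y))%:R)).

Definition stationary_probability (R : realType) (V : finType)
    (Q : config V -> config V -> R) (G : probability (config V) R) : Prop :=
  stationary_distribution Q (fun xi => fine (G [set xi])).

Definition opinion_sum (R : realType) (V : finType) (pi : V -> R)
    (xi : config V) : R :=
  \sum_(x : V) pi x * (xi x)%:R.

Definition opinion_sd (R : realType) (V : finType) (pi : V -> R)
    (G : probability (config V) R) : R :=
  Num.sqrt (fine 'V_G[opinion_sum pi]).

Definition standardized_sum (R : realType) (V : finType) (pi : V -> R)
    (G : probability (config V) R) (xi : config V) : R :=
  (opinion_sum pi xi - fine 'E_G[opinion_sum pi]) / opinion_sd pi G.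

HB.instance Definition _ (R : realType) (V : finType) (pi : V -> R)
    (G : probability (config V) R) :=
  @isMeasurableFun.Build _ _ (config V) R (standardized_sum pi G)
    (fun _ _ _ => I).

(* Pointwise convergence of the distribution functions at every continuity
   point of the limiting one. *)
Definition cvg_in_distribution (R : realType) (d : nat -> measure_display)
    (T : forall n, measurableType (d n)) (P : forall n, probability (T n) R)
    (X : forall n, {RV (P n) >-> R})
    (mu : probability (measurableTypeR R) R) : Prop :=
  forall t : R, {for t, continuous (fun s : R => mu [set` `]-oo, s]])} ->
    cdf (X n) t @[n --> \oo] --> mu [set` `]-oo, t]].

(* Main.v *)
Require Import Defs.
From HB Require Import structures.
From mathcomp Require Import all_boot all_order all_algebra.
From mathcomp Require Import all_classical all_reals all_analysis.
From mathcomp Require Import ring lra.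

Set Implicit Arguments.
Unset Strict Implicit.
Unset Printing Implicit Defensive.

Import Order.TTheory GRing.Theory Num.Theory.
Import numFieldNormedType.Exports.

Local Open Scope classical_set_scope.
Local Open Scope ring_scope.

(** Write [W] for the standardized sum and [Delta] for the change of
[S = \sum_x pi x * xi x] in one step of the noisy voter model on [n] vertices.
The proof is Stein's method for the stationary chain, with the linear drift of
[S] in the role of the regression condition.

Stationarity of [pi] for [P] makes the copying moves a martingale for [S], so
only the coin flips contribute to the drift, which is [(p / n) * (1/2 - S)]
(lemma [jump_drift]).  Let [A] be the conditional mean of [Delta ^+ 2].
Since [S] and [S ^+ 2] have the same mean before and after a step, [S] has mean
[1/2] and [A] has mean [2 * (p / n) * Var S].  The vertex chosen by a step
changes its opinion with probability at least [p / 2], so that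
[Var S >= (\sum_x pi x ^+ 2) / 4] ([opinion_var_ge]).  Let [W'] be [W] after
one step.  Expanding the identity [E F(W') = E F(W)] to second order, for a
test function [F] with derivative [f], shows that [E (f'(W) - W f(W))] is the
sum of two errors:
- the cubic remainder, of order [(m / sd) ^+ 3 * n / p] with [m] a bound on
  [pi] and [sd] the standard deviation of [S];
- the fluctuation of [A].  Two copies of the chain driven by the same moves
  contract the [pi]-weighted Hamming distance by the factor [1 - p / n]
  ([dist_step]), and the squared distance travelled in one step is [Delta ^+ 2].
  This yields a Poincare inequality for Lipschitz functions ([poincare]), hence
  a standard deviation of order [m * sd / n] for [A], and an error of order
  [m / (p * sd)].
With [a := m / Num.sqrt (\sum_x pi x ^+ 2)] both errors are of order
[a ^+ 3 * n / p], because [a ^+ 2 * n >= 1] ([stein_bound_ratio]).  On a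
connected graph [pi] is proportional to the degree
([stationary_random_walk]), so this is the quantity assumed to tend to [0].

To pass from [E (f'(W) - W f(W)) --> 0] to convergence of the distribution
functions, only compactly supported right-hand sides are used.  If [h] is
Lipschitz with compact support and Gaussian mean [0], the solution
[f x = \int_(y <= x) h y * phi y / phi x] of [f' - x f = h] vanishes outside
the support, so every bound on [f] and [f'] comes from compactness
([stein_equation]).  Combining two bumps, one of them wide and equal to [1] on
most of the mass of [W] because [E W ^+ 2 = 1], removes the constraint on the
Gaussian mean and bounds the liminf of [E h(W)] from below for every bump
([liminf_bump]).  Bumps exhaust the two half-lines cut at [t], which bounds the
distribution function at [t] from both sides ([cdf_cvg_normal]). *)

(** * Averages over a finite set *)

Section Mean.
Context {R : realType} {T : finType} (w : T -> R).

Definition mean (f : T -> R) : R := \sum_x w x * f x.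

Lemma meanD f g : mean (fun x => f x + g x) = mean f + mean g.
Proof. by rewrite /mean -big_split; apply: eq_bigr => x _; rewrite mulrDr. Qed.

Lemma meanZ c f : mean (fun x => c * f x) = c * mean f.
Proof. by rewrite /mean mulr_sumr; apply: eq_bigr => x _; rewrite mulrCA. Qed.

Lemma meanB f g : mean (fun x => f x - g x) = mean f - mean g.
Proof.
rewrite -mulN1r -meanZ -meanD; congr mean.
by apply/funext => x; rewrite mulN1r.
Qed.

Lemma eq_mean f g : f =1 g -> mean f = mean g.
Proof. by move=> fg; congr mean; apply/funext. Qed.

Hypothesis w_ge0 : forall x, 0 <= w x.
Hypothesis w_sum1 : \sum_x w x = 1.

Lemma mean_cst c : mean (fun=> c) = c.
Proof. by rewrite /mean -mulr_suml w_sum1 mul1r. Qed.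

Lemma le_mean f g : (forall x, f x <= g x) -> mean f <= mean g.
Proof. by move=> fg; apply: ler_sum => x _; rewrite ler_wpM2l. Qed.

Lemma norm_mean_le f : `|mean f| <= mean (fun x => `|f x|).
Proof.
apply: le_trans (ler_norm_sum _ _ _) _; apply: ler_sum => x _.
by rewrite normrM ger0_norm.
Qed.

Lemma sqr_mean_le f : mean f ^+ 2 <= mean (fun x => f x ^+ 2).
Proof.
rewrite -subr_ge0.
have <- : mean (fun x => (f x - mean f) ^+ 2) =
    mean (fun x => f x ^+ 2) - mean f ^+ 2.
  rewrite (@eq_mean _ (fun x => f x ^+ 2 - (2 * mean f) * f x
      + mean f ^+ 2)); last by move=> x /=; ring.
  by rewrite meanD meanB meanZ mean_cst; ring.
by rewrite -(mean_cst 0); apply: le_mean => x; rewrite sqr_ge0.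
Qed.

End Mean.

Arguments eq_mean {R T w f g}.

(** * Stein's equation for compactly supported test functions *)

Section Calculus.
Context {R : realType}.
Local Notation mu := (@lebesgue_measure R).
Implicit Types (f g h : R -> R) (a b x : R).

Lemma is_derive_continuous f df : (forall x, is_derive x 1 f (df x)) ->
  continuous f.
Proof.
move=> fdf x; apply: differentiable_continuous.
by apply/derivable1_diffP; have [] := fdf x.
Qed.

Lemma lipschitz_continuous h L :
  (forall x y, `|h x - h y| <= L * `|x - y|) -> continuous h.
Proof.
move=> hL x; apply/cvgrPdist_le => e e0.
have L0 : 0 <= L.
  have := hL 1 0; rewrite subr0 normr1 mulr1; exact: le_trans.
have L1 : 0 < L + 1 by rewrite ltr_wpDl.
near=> y; apply: le_trans (hL _ _) _.
apply: (@le_trans _ _ ((L + 1) * (e / (L + 1)))).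
  apply: ler_pM => //; first by rewrite lerDl.
  near: y; apply: cvgr_dist_le; [exact: cvg_id|exact: divr_gt0].
by rewrite mulrC divfK // gt_eqF.
Unshelve. all: by end_near.
Qed.

(** The bound on the derivative is only asked at points no farther from [a]
than [b], so that the remainder below can be estimated by iterating it. *)
Lemma mean_value_bound f df a b K : (forall x, is_derive x 1 f (df x)) ->
  (forall c, `|c - a| <= `|b - a| -> `|df c| <= K) ->
  `|f b - f a| <= K * `|b - a|.
Proof.
move=> fdf dfK; have cf := is_derive_continuous fdf.
have [ab|/ltW ba] := leP a b.
  have [c cab ->] := MVT_segment ab (fun x _ => fdf x)
    (continuous_subspaceT cf).
  rewrite normrM ler_wpM2r //; apply: dfK.
  by move: cab; rewrite in_itv /= => /andP[ac cb]; rewrite !ger0_norm; lra.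
have [c cab E] := MVT_segment ba (fun x _ => fdf x) (continuous_subspaceT cf).
rewrite distrC E normrM [X in _ <= _ * X]distrC ler_wpM2r //; apply: dfK.
by move: cab; rewrite in_itv /= => /andP[bc ca]; rewrite !ler0_norm; lra.
Qed.

(** Taylor's formula with a cubic remainder, where [f] and [f2] stand for the
first two derivatives of [F]; in this form it applies directly to the finite
jumps of the chain. *)
Definition cubic_remainder (C : R) F f f2 : Prop := forall a b,
  `|F b - F a - f a * (b - a) - f2 a * (b - a) ^+ 2 / 2| <= C * `|b - a| ^+ 3.

Lemma taylor2_lipschitz F f f2 L : (forall x, is_derive x 1 F (f x)) ->
  (forall x, is_derive x 1 f (f2 x)) ->
  (forall x y, `|f2 x - f2 y| <= L * `|x - y|) ->
  cubic_remainder L F f f2.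
Proof.
move=> dF df f2L a b.
have L0 : 0 <= L.
  have := f2L 1 0; rewrite subr0 normr1 mulr1; exact: le_trans.
have f_le c : `|c - a| <= `|b - a| ->
    `|f c - f a - f2 a * (c - a)| <= L * `|b - a| ^+ 2.
  move=> cb; pose g x := f x - f2 a * x.
  have dg x : is_derive x 1 g (f2 x - f2 a).
    by apply: is_derive_eq; rewrite /GRing.scale /=; ring.
  have -> : f c - f a - f2 a * (c - a) = g c - g a by rewrite /g; ring.
  rewrite expr2 mulrA; apply: le_trans (ler_wpM2l _ cb); last first.
    by rewrite mulr_ge0.
  apply: mean_value_bound dg _ => x xc; apply: le_trans (f2L _ _) _.
  by rewrite ler_wpM2l // (le_trans xc).
pose g x := F x - f a * x - f2 a * (x - a) ^+ 2 / 2.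
have dg x : is_derive x 1 g (f x - f a - f2 a * (x - a)).
  by apply: is_derive_eq; rewrite /GRing.scale /=; field.
have -> : F b - F a - f a * (b - a) - f2 a * (b - a) ^+ 2 / 2 = g b - g a.
  by rewrite /g; field.
by rewrite exprSr mulrA; apply: mean_value_bound dg _.
Qed.

Definition supported (M : R) f : Prop := forall x, M <= `|x| -> f x = 0.

Lemma supported_bounded M f : continuous f -> supported M f ->
  exists B, forall x, `|f x| <= B.
Proof.
move=> cf fM.
have M0 : - `|M| <= `|M| by have := normr_ge0 M; lra.
have [c _ cmax] := @EVT_max R (fun x => `|f x|) _ _ M0 (continuous_subspaceT
  (fun x => cvg_norm (cf x))).
exists `|f c| => x; have [xM|Mx] := leP `|x| `|M|.
  by apply: cmax; rewrite in_itv /= -ler_norml.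
by rewrite fM ?normr0 // (le_trans (ler_norm M)) // ltW.
Qed.

Lemma supported_integrable M f : continuous f -> supported M f ->
  mu.-integrable setT (EFin \o f).
Proof.
move=> cf fM.
have fi : mu.-integrable `[- M, M] (EFin \o f).
  apply: continuous_compact_integrable; first exact: segment_compact.
  exact: continuous_subspaceT.
have := @eq_integrable _ _ R mu setT measurableT
  ((EFin \o f) \_ `[- M, M]) (EFin \o f).
apply; last first.
  by apply/(integrable_mkcond _ _).1.
move=> x _.
rewrite patchE; case: ifPn => // xM /=; rewrite fM //.
apply: ltW; rewrite ltNge; apply: contra xM => xM.
by rewrite inE /= in_itv /= -ler_norml.
Qed.

(** The primitive vanishing at minus infinity; its value to the right of the
support is what turns a mean-zero condition into compact support. *)
Lemma supported_primitive M f : continuous f -> supported M f ->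
  exists2 F : R -> R, forall x, is_derive x 1 F (f x) &
    (forall x, x <= - `|M| -> F x = 0) /\
    (forall x, `|M| <= x -> F x = \int[mu]_y f y).
Proof.
move=> cf fM; have fi := supported_integrable cf fM.
exists (fun x => \int[mu]_(t in `]-oo, x]) f t) => [x|].
  have fi1 : mu.-integrable [set` `]-oo, x + 1]] (EFin \o f).
    exact: integrableS fi.
  have x1 : x < x + 1 by rewrite ltrDl.
  have [dF <-] := continuous_FTC1 x1 fi1 (ltNyr x) (cf x).
  by rewrite derive1E; exact/derivableP.
have MM := ler_norm M.
split=> x xM.
  rewrite (@eq_Rintegral _ _ _ mu _ (cst 0)) ?Rintegral_cst ?mul0r //.
  move=> y; rewrite inE /= in_itv /= => yx; rewrite fM //.
  by rewrite ler0_norm; have := normr_ge0 M; lra.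
rewrite Rintegral_mkcond; congr (fine _); apply: eq_integral => y _.
rewrite patchE; case: ifPn => //.
rewrite notin_setE /= in_itv /= => /negP; rewrite -ltNge => xy; rewrite fM //.
by rewrite ger0_norm; have := normr_ge0 M; lra.
Qed.

Lemma normal_pdf_derive x :
  is_derive x 1 (normal_pdf (0 : R) 1) (- x * normal_pdf 0 1 x).
Proof.
pose k : R := normal_peak 1.
pose u (y : R) := - (y - 0) ^+ 2 / (1 ^+ 2 *+ 2).
have -> : normal_pdf (0 : R) 1 = fun y => k * (expR \o u) y.
  by rewrite normal_pdfE ?oner_neq0.
have du : is_derive x 1 u (- x).
  by apply: is_derive_eq; rewrite /GRing.scale /=; field.
have de := is_derive1_comp (is_derive_expR (u x)) du.
apply: is_derive_eq.
by rewrite /GRing.scale /= /u; ring.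
Qed.

Lemma normal_pdf_gt0 x : 0 < normal_pdf (0 : R) 1 x.
Proof.
by rewrite normal_pdfE ?mulr_gt0 ?expR_gt0 ?normal_peak_gt0 ?oner_neq0.
Qed.

(** With [phi] the Gaussian density and [G] the primitive of [h \* phi], the
function [f := G / phi] solves [f' - x f = h] because [phi' = - x phi].  The
mean-zero hypothesis makes [G], hence [f], vanish to the right of the support.
Then [f' = h + x f] is Lipschitz as the sum of [h] and of a function whose
derivative is continuous with compact support. *)
Lemma stein_equation h M L : supported M h ->
  (forall x y, `|h x - h y| <= L * `|x - y|) ->
  \int[mu]_x (h x * normal_pdf 0 1 x) = 0 ->
  exists F f f2 : R -> R, exists C B : R,
    [/\ cubic_remainder C F f f2,
        forall x, `|f2 x| <= B &
        forall x, f2 x - x * f x = h x].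
Proof.
pose phi := normal_pdf (0 : R) 1.
move=> hM hL h0.
have ch : continuous h := lipschitz_continuous hL.
have cphi : continuous phi by apply: continuous_normal_pdf; rewrite oner_neq0.
have hphiM : supported M (h \* phi) by move=> x xM /=; rewrite hM // mul0r.
have chphi : continuous (h \* phi).
  by move=> x; apply: cvgM; [exact: ch|exact: cphi].
have [G dG [Glow Ghigh]] := supported_primitive chphi hphiM.
have phi0 x : phi x != 0 by rewrite gt_eqF // normal_pdf_gt0.
pose f x := G x / phi x; pose f2 x := h x + x * f x.
have fM : supported `|M| f.
  move=> x; rewrite ler_normr /f => /orP[xM|xM].
    by rewrite Ghigh // h0 mul0r.
  by rewrite Glow ?mul0r //; lra.
have df x : is_derive x 1 f (f2 x).
  have dV := is_deriveV (phi0 x) (normal_pdf_derive x).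
  have dGx := dG x; apply: is_derive_eq.
  by rewrite /GRing.scale /= /f2 /f -/phi; field; exact: phi0.
have cf : continuous f := is_derive_continuous df.
have cf2 : continuous f2.
  move=> x; apply: cvgD; first exact: ch.
  by apply: cvgM; [exact: cvg_id|exact: cf].
have f2M : supported `|M| f2.
  by move=> x xM; rewrite /f2 fM // hM ?(le_trans (ler_norm M)) // mulr0 addr0.
have [F dF _] := supported_primitive cf fM.
have [B f2B] := supported_bounded cf2 f2M.
pose dxf x := f x + x * f2 x.
have dxfM : supported `|M| dxf.
  by move=> x xM; rewrite /dxf fM // f2M // mulr0 addr0.
have cdxf : continuous dxf.
  move=> x; apply: cvgD; first exact: cf.
  by apply: cvgM; [exact: cvg_id|exact: cf2].
have [K dxfK] := supported_bounded cdxf dxfM.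
have ddxf x : is_derive x 1 (fun y => y * f y) (dxf x).
  have dfx := df x; apply: is_derive_eq.
  by rewrite /GRing.scale /= /dxf; ring.
exists F, f, f2, (L + K), B; split => // [|x]; last by rewrite /f2 addrK.
apply: taylor2_lipschitz dF df _ => x y.
rewrite /f2 opprD addrACA mulrDl; apply: le_trans (ler_normD _ _) _.
apply: lerD => //.
exact: (mean_value_bound ddxf (fun c _ => dxfK c)).
Qed.

End Calculus.

(** * From Stein's identity to distribution functions *)

Section Portmanteau.
Context {R : realType}.
Local Notation mu := (@lebesgue_measure R).

Definition clip (z : R) : R := Num.max 0 (Num.min 1 z).

Lemma clip_lipschitz u v : `|clip u - clip v| <= `|u - v|.
Proof.
have := ler_norm (u - v); have := ler_norm (v - u); rewrite distrC => h1 h2.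
have m01 : Num.max 0 1 = 1 :> R by rewrite max_r.
rewrite ler_norml /clip.
by case: (leP 1 u) => ?; case: (leP 1 v) => ?; rewrite ?m01;
  case: (leP 0 u) => ?; case: (leP 0 v) => ?; lra.
Qed.

(** A trapezoid supported in [|x - c| <= r] and equal to [1] on
[|x - c| <= r - 1 / r]; one parameter governs both its width and its slope, so
that the intervals below have length tending to infinity and vanishing
margins. *)
Definition bump (c r x : R) : R := clip (r * (r - `|x - c|)).

Lemma bump_ge0 c r x : 0 <= bump c r x.
Proof. by rewrite le_max lexx. Qed.

Lemma bump_le1 c r x : bump c r x <= 1.
Proof. by rewrite ge_max ler01 ge_min lexx. Qed.

Lemma bump1 c r x : 0 < r -> `|x - c| <= r - r^-1 -> bump c r x = 1.
Proof.
move=> r0 xc; rewrite /bump /clip min_l ?max_r //.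
by rewrite -ler_pdivrMl // mulr1; lra.
Qed.

Lemma bump0 c r x : 0 < r -> r <= `|x - c| -> bump c r x = 0.
Proof.
move=> r0 xc; rewrite /bump /clip max_l // ge_min pmulr_rle0 //.
by rewrite subr_le0 xc orbT.
Qed.

Lemma bump_lipschitz c r x y : 0 < r ->
  `|bump c r x - bump c r y| <= r * `|x - y|.
Proof.
move=> r0; apply: le_trans (clip_lipschitz _ _) _.
rewrite -mulrBr normrM gtr0_norm // ler_pM2l // opprB addrC subrKA.
rewrite distrC (_ : x - y = (x - c) - (y - c)); last by ring.
exact: ler_dist_dist.
Qed.

Definition gauss_mean (h : R -> R) : R := \int[mu]_x (h x * normal_pdf 0 1 x).

Lemma bump_pdf_integrable c r : 0 < r ->
  mu.-integrable setT (EFin \o (fun x => bump c r x * normal_pdf 0 1 x)).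
Proof.
move=> r0; apply: (@supported_integrable _ (`|c| + r)).
  move=> x; apply: cvgM; last first.
    by apply: continuous_normal_pdf; rewrite oner_neq0.
  by apply: (@lipschitz_continuous R _ r) => y z; exact: bump_lipschitz.
move=> x xc; rewrite bump0 ?mul0r //.
have := lerB_dist x c; lra.
Qed.

Lemma gauss_mean_bump_le1 c r : 0 < r -> gauss_mean (bump c r) <= 1.
Proof.
move=> r0.
have -> : 1 = \int[mu]_x (normal_pdf (0 : R) 1 x).
  by rewrite /Rintegral integral_normal_pdf.
apply: le_Rintegral => //.
- exact: bump_pdf_integrable.
- exact: integrable_normal_pdf.
move=> x _; rewrite ler_piMl ?bump_le1 //; exact/ltW/normal_pdf_gt0.
Qed.

Lemma le_gauss_mean_bump c r (A : set R) : 0 < r ->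
  measurable (A : set (measurableTypeR R)) ->
  (forall x, A x -> `|x - c| <= r - r^-1) ->
  fine (normal_prob (0 : R) 1 A) <= gauss_mean (bump c r).
Proof.
move=> r0 mA Ac.
rewrite (_ : fine _ = \int[mu]_(x in A) normal_pdf 0 1 x) //.
rewrite Rintegral_mkcond; apply: le_Rintegral => //.
- rewrite -restrict_EFin; apply/(integrable_mkcond _ _).1 => //.
  apply: (integrableS measurableT) => //; exact: integrable_normal_pdf.
- exact: bump_pdf_integrable.
move=> x _; rewrite patchE; case: ifPn => [|_].
  by rewrite inE => /Ac xc; rewrite bump1 // mul1r.
by rewrite mulr_ge0 ?bump_ge0 //; exact/ltW/normal_pdf_gt0.
Qed.

Context (T : nat -> finType) (w : forall n, T n -> R) (X : forall n, T n -> R).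
Hypothesis w_ge0 : forall n, (0 < n)%N -> forall x : T n, 0 <= w x.
Hypothesis w_sum1 : forall n, (0 < n)%N -> \sum_(x : T n) w x = 1.
Hypothesis X_sqr : forall n, (0 < n)%N -> mean (@w n) (fun x => X x ^+ 2) = 1.
Local Notation E n h := (mean (@w n) (fun x => h (X x))).
Hypothesis stein : forall (F f f2 : R -> R) (C B : R),
  cubic_remainder C F f f2 ->
  (forall x, `|f2 x| <= B) ->
  E n (fun y => f2 y - y * f y) @[n --> \oo] --> (0 : R).

(** For bumps [I] and [J] with Gaussian means [NI] and [NJ], the combination
[NJ * I - NI * J] is an admissible right-hand side of Stein's equation, so
[NJ * E I - NI * E J] tends to [0].  As [NJ <= 1], this bounds [E I] from below
by [NI * E J] up to [o(1)], and [E J] is close to [1] by Chebyshev's inequality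
once [J] is wide. *)
Lemma liminf_bump c r (e : R) : 0 < r -> 0 < e ->
  \forall n \near \oo, gauss_mean (bump c r) - e <= E n (bump c r).
Proof.
move=> r0 e0.
(* [M] is chosen so that Chebyshev loses at most [e / 2]. *)
pose M : R := 1 + 2 / e.
have M0 : 0 < M by rewrite ltr_pwDl ?divr_ge0 // ltW.
have M2 : (M ^+ 2)^-1 <= e / 2.
  rewrite -[leRHS]invrK lef_pV2 ?posrE ?exprn_gt0 ?invr_gt0 ?divr_gt0 //.
  rewrite invf_div /M; have : 0 < 2 / e by rewrite divr_gt0.
  by set q := 2 / e; nra.
have s0 : 0 < M + 1 by rewrite addr_gt0.
pose NI := gauss_mean (bump c r); pose NJ := gauss_mean (bump 0 (M + 1)).
pose h x := NJ * bump c r x - NI * bump 0 (M + 1) x.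
have hM : supported (`|c| + r + (M + 1)) h.
  move=> x xM; rewrite /h !bump0 ?mulr0 ?subr0 //.
    by rewrite (le_trans _ xM) // lerDr addr_ge0 // ltW.
  have := lerB_dist x c; lra.
have hL x y : `|h x - h y| <= (`|NJ| * r + `|NI| * (M + 1)) * `|x - y|.
  rewrite /h (_ : _ - _ = NJ * (bump c r x - bump c r y)
    - NI * (bump 0 (M + 1) x - bump 0 (M + 1) y)); last by ring.
  apply: le_trans (ler_normB _ _) _; rewrite !normrM mulrDl -!mulrA.
  by rewrite lerD // ler_wpM2l // bump_lipschitz.
have h0 : \int[mu]_x (h x * normal_pdf 0 1 x) = 0.
  have iI := bump_pdf_integrable c r0; have iJ := bump_pdf_integrable 0 s0.
  transitivity (\int[mu]_x (NJ * (bump c r x * normal_pdf 0 1 x) -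
      NI * (bump 0 (M + 1) x * normal_pdf 0 1 x))).
    by apply: eq_Rintegral => x _; rewrite /h; ring.
  rewrite RintegralB //; last 2 first.
  - exact: (integrableZl _ NJ iI).
  - exact: (integrableZl _ NI iJ).
  by rewrite !RintegralZl // -/(gauss_mean _) -/NI -/NJ mulrC subrr.
have [F [f [f2 [C [B [taylor f2B fh]]]]]] := stein_equation hM hL h0.
have /cvgr0Pnorm_le cv := stein taylor f2B.
have e2 : 0 < e / 2 by rewrite divr_gt0.
near=> n.
have n0 : (0 < n)%N by near: n; exact: nbhs_infty_gt.
have : `|E n (fun y => f2 y - y * f y)| <= e / 2 by near: n; exact: cv.
rewrite (eq_mean (g := fun x => NJ * bump c r (X x)
  - NI * bump 0 (M + 1) (X x))); last by move=> x; rewrite fh.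
rewrite meanB !meanZ; set EI := E n _; set EJ := mean _ _.
have EJ1 : 1 - (M ^+ 2)^-1 <= EJ.
  have <- : mean (@w n) (fun x => 1 - (M ^+ 2)^-1 * X x ^+ 2) = 1 - (M ^+ 2)^-1.
    by rewrite meanB meanZ X_sqr // mean_cst ?w_sum1 // mulr1.
  apply: le_mean; first exact: w_ge0.
  move=> x; have [xM|Mx] := leP `|X x| M.
    rewrite bump1 ?subr0 //.
      by rewrite gerBl mulr_ge0 ?invr_ge0 ?sqr_ge0.
    apply: le_trans xM _; rewrite -addrA lerDl subr_ge0 invf_le1 //.
    by rewrite lerDr ltW.
  apply: le_trans (bump_ge0 _ _ _); rewrite subr_le0.
  rewrite -(real_normK (num_real (X x))) mulrC ler_pdivlMr ?exprn_gt0 //.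
  by rewrite mul1r ler_sqr ?nnegrE ?(ltW M0) // ltW.
have EI0 : 0 <= EI.
  by apply: sumr_ge0 => x _; rewrite mulr_ge0 ?w_ge0 ?bump_ge0.
have NI0 : 0 <= NI.
  rewrite /NI /gauss_mean; apply: Rintegral_ge0 => x _.
  by rewrite mulr_ge0 ?bump_ge0 //; exact/ltW/normal_pdf_gt0.
have NI1 : NI <= 1 := gauss_mean_bump_le1 c r0.
have NJ1 : NJ <= 1 := gauss_mean_bump_le1 0 s0.
rewrite ler_norml => /andP[h1 _].
have h2 : NJ * EI <= EI by rewrite ler_piMl.
have h3 : NI * (1 - (M ^+ 2)^-1) <= NI * EJ by rewrite ler_wpM2l.
have h4 : NI * (M ^+ 2)^-1 <= e / 2.
  by apply: le_trans M2; rewrite ler_piMl // invr_ge0 sqr_ge0.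
rewrite mulrBr mulr1 in h3; rewrite -/NI; lra.
Unshelve. all: by end_near.
Qed.

(** The sign [s] selects the half-line [x < t] or [x > t].  Bumps centred at
[t - s * r] with radius [r] are supported in the half-line, and their plateaus
[A N] increase to it. *)
Lemma liminf_halfline (s t e : R) : s * s = 1 -> 0 < e ->
  \forall n \near \oo,
    fine (normal_prob (0 : R) 1 [set x | 0 < s * (t - x)]) - e
      <= E n (fun x => (0 < s * (t - x))%R%:R).
Proof.
move=> ss e0.
have [r rE] : exists r : nat -> R, forall N, r N = N.+1%:R
  by exists (fun N => N.+1%:R).
have r0 N : 0 < r N by rewrite rE ltr0n.
pose c N := t - s * r N.
pose A N : set (measurableTypeR R) := [set x | `|x - c N| <= r N - (r N)^-1].
have mA N : measurable (A N).
  rewrite (_ : A N = `[c N - (r N - (r N)^-1), c N + (r N - (r N)^-1)]%classic).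
    exact: measurable_itv.
  by apply/seteqP; split=> x; rewrite /A /= in_itv /= ler_distl.
have sn : `|s| = 1.
  by apply/eqP; rewrite -sqrp_eq1 // real_normK ?num_real // expr2 ss.
have AE N x : A N x <-> (r N)^-1 <= s * (t - x) <= 2 * r N - (r N)^-1.
  rewrite /A /= (_ : `|x - c N| = `|s * (x - c N)|); last first.
    by rewrite normrM sn mul1r.
  have -> : s * (x - c N) = r N - s * (t - x).
    by rewrite /c mulrBr mulrBr mulrA ss; ring.
  rewrite ler_norml; split=> /andP[h1 h2]; apply/andP; split; lra.
have UA : \bigcup_N A N = [set x | 0 < s * (t - x)].
  apply/seteqP; split => x /=.
    by case=> N _ /AE /andP[+ _]; apply: lt_le_trans; rewrite invr_gt0.
  move=> u0; set u := s * (t - x) in u0.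
  have [N Nu] : exists N, u^-1 + u <= r N.
    exists (Num.truncn (u^-1 + u)).
    by apply: ltW; rewrite rE; apply: truncnS_gt.
  have ui0 : 0 < u^-1 by rewrite invr_gt0.
  exists N => //; apply/AE; rewrite -/u.
  have h1 : (r N)^-1 <= u.
    by rewrite -[leRHS]invrK lef_pV2 ?posrE //; lra.
  rewrite h1 /=; lra.
have Ahomo : {homo A : n m / (n <= m)%N >-> (n <= m)%O}.
  move=> n m nm; rewrite subsetEset => x /AE /andP[h1 h2]; apply/AE.
  have rnm : r n <= r m by rewrite !rE ler_nat.
  have rV : (r m)^-1 <= (r n)^-1 by rewrite lef_pV2 ?posrE.
  by apply/andP; split; lra.
have mU : measurable (\bigcup_N A N) by exact: bigcup_measurable.
have := nondecreasing_cvg_mu (mu := normal_prob (0 : R) 1) mA mU Ahomo.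
rewrite UA => cvA.
have /fine_cvg : normal_prob 0 1 (A N) @[N --> \oo] -->
    (fine (normal_prob (0 : R) 1 [set x | 0 < s * (t - x)]))%:E.
  by rewrite fineK ?fin_num_measure // -UA.
have e2 : 0 < e / 2 by rewrite divr_gt0.
move=> /cvgrPdist_le /(_ _ e2) [N _ /(_ N (leqnn N))] /=.
rewrite ler_norml => /andP[_ hN].
have hc := le_gauss_mean_bump (r0 N) (mA N) (fun x => id).
near=> n.
have n0 : (0 < n)%N by near: n; exact: nbhs_infty_gt.
apply: (@le_trans _ _ (E n (bump (c N) (r N)))).
  apply: (@le_trans _ _ (gauss_mean (bump (c N) (r N)) - e / 2)).
    by move: hN hc; lra.
  by near: n; exact: liminf_bump.
apply: le_mean; first exact: w_ge0.
move=> x; have [_|u0] := ltP 0 (s * (t - X x)); first exact: bump_le1.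
rewrite bump0 //.
rewrite (_ : `|X x - c N| = `|s * (X x - c N)|); last first.
  by rewrite normrM sn mul1r.
have -> : s * (X x - c N) = r N - s * (t - X x).
  by rewrite /c mulrBr mulrBr mulrA ss; ring.
by rewrite ger0_norm; have := r0 N; lra.
Unshelve. all: by end_near.
Qed.

(** The two half-lines bound the distribution function from both sides, and
the bounds agree since the Gaussian law has no atom at [t]. *)
Lemma cdf_cvg_normal (t : R) :
  E n (fun x => (x <= t)%R%:R) @[n --> \oo] -->
    fine (normal_prob (0 : R) 1 [set` `]-oo, t]]).
Proof.
pose g : probability (measurableTypeR R) R := normal_prob (0 : R) 1.
have lo : fine (g [set x | 0 < 1 * (t - x)]) = fine (g [set` `]-oo, t]]).
  congr fine; rewrite (_ : [set x | 0 < 1 * (t - x)] = [set` `]-oo, t[]);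
    last first.
    by apply/seteqP; split=> x; rewrite /= in_itv /= mul1r subr_gt0.
  rewrite -(@setUitv1 _ _ -oo%O t true) // measureU //; last first.
    by apply/seteqP; split=> x //= [xt xE]; move: xt; rewrite xE in_itv /= ltxx.
  by rewrite [X in (_ + X)%E](_ : _ = 0%E) ?adde0 //; exact: integral_set1.
have hi : fine (g [set x | 0 < -1 * (t - x)]) = 1 - fine (g [set` `]-oo, t]]).
  rewrite (_ : [set x | 0 < -1 * (t - x)] = ~` [set` `]-oo, t]]); last first.
    apply/seteqP; split=> x; rewrite /= in_itv /= mulN1r opprB subr_gt0 ltNge.
      by move/negP.
    by move/negP.
  by rewrite probability_setC // fineB ?fin_num_measure.
apply/cvgrPdist_le => e e0; near=> n.
have n0 : (0 < n)%N by near: n; exact: nbhs_infty_gt.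
have h1 : fine (g [set x | 0 < 1 * (t - x)]) - e
    <= E n (fun x => (0 < 1 * (t - x))%R%:R).
  by near: n; apply: liminf_halfline => //; rewrite mulr1.
have h2 : fine (g [set x | 0 < -1 * (t - x)]) - e
    <= E n (fun x => (0 < -1 * (t - x))%R%:R).
  by near: n; apply: liminf_halfline => //; rewrite mulrNN mulr1.
rewrite lo in h1; rewrite hi in h2.
have h3 : E n (fun x => (0 < 1 * (t - x))%R%:R) <= E n (fun x => (x <= t)%R%:R).
  apply: le_mean; first exact: w_ge0.
  by move=> x; rewrite mul1r subr_gt0 ler_nat; case: ltP => // /ltW ->.
have h4 : E n (fun x => (0 < -1 * (t - x))%R%:R) =
    1 - E n (fun x => (x <= t)%R%:R).
  rewrite -[X in X - _](mean_cst (w_sum1 n0)) -meanB; apply: eq_mean => x.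
  rewrite /= mulN1r opprB subr_gt0 ltNge; case: (X x <= t);
    by rewrite ?subrr ?subr0.
rewrite -/g; rewrite h4 in h2; rewrite ler_norml; apply/andP; split; lra.
Unshelve. all: by end_near.
Qed.

End Portmanteau.

(** * One step of the noisy voter model *)

Section NoisyVoter.
Context (R : realType) (V : finType) (P : V -> V -> R) (p : R).
Context (pi : V -> R) (w : config V -> R).
Hypothesis P_ge0 : forall x y, 0 <= P x y.
Hypothesis P_sum : forall x, \sum_y P x y = 1.
Hypothesis p_range : 0 < p <= 1.
Hypothesis pi_stat : stationary_distribution P pi.
Hypothesis w_stat : stationary_distribution (nvm P p) w.

Local Notation n := (#|V|%:R : R).
Local Notation S := (opinion_sum pi).

(** A move [(x, a)] updates the vertex [x], by the coin [b] when [a = inl b]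
and by copying [y] when [a = inr y].  The probability of a move does not depend
on the configuration, so that [act] also couples copies of the chain started
from different configurations. *)
Definition new_opinion (xi : config V) (a : bool + V) : bool :=
  match a with inl b => b | inr y => xi y end.

Definition act (i : V * (bool + V)) (xi : config V) : config V :=
  update xi i.1 (new_opinion xi i.2).

Definition weight (i : V * (bool + V)) : R :=
  n^-1 * match i.2 with inl _ => p / 2 | inr y => (1 - p) * P i.1 y end.

Definition step (f : config V -> R) (xi : config V) : R :=
  \sum_i weight i * f (act i xi).

Local Notation mean := (mean w).

Let w_ge0 xi : 0 <= w xi. Proof. by case: w_stat. Qed.
Let w_sum1 : \sum_xi w xi = 1. Proof. by case: w_stat. Qed.
Let mean_cst := mean_cst w_sum1.
Let le_mean := le_mean w_ge0.
Let norm_mean_le := norm_mean_le w_ge0.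
Let sqr_mean_le := sqr_mean_le w_ge0 w_sum1.

Lemma cardV_gt0 : 0 < n.
Proof.
have [_ pi1 _] := pi_stat.
rewrite ltr0n; apply/card_gt0P; case: (pickP V) => [x _|V0]; first by exists x.
by move: pi1; rewrite big_pred0 // => /eqP; rewrite eq_sym oner_eq0.
Qed.

Lemma sum_moves (F : V * (bool + V) -> R) :
  \sum_i F i = \sum_x (\sum_b F (x, inl b) + \sum_y F (x, inr y)).
Proof.
rewrite (eq_bigr (fun i => F (i.1, i.2))); last by case.
rewrite -(pair_bigA _ (fun x a => F (x, a))) /=.
by apply: eq_bigr => x _; rewrite big_sumType.
Qed.

Lemma weight_ge0 i : 0 <= weight i.
Proof.
have /andP[p0 p1] := p_range.
rewrite mulr_ge0 ?invr_ge0 ?ler0n //; case: i.2 => [_|y]; first by lra.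
by rewrite mulr_ge0 // subr_ge0.
Qed.

Lemma weight_sum1 : \sum_i weight i = 1.
Proof.
rewrite sum_moves /weight /=.
under eq_bigr => x _ do
  rewrite -!mulr_sumr P_sum mulr1 sumr_const card_bool -mulrDr.
rewrite sumr_const -[LHS]mulr_natl mulrA divff ?gt_eqF ?cardV_gt0 // mul1r.
by rewrite -mulr_natr; field.
Qed.

Lemma step_cst c : step (fun=> c) =1 fun=> c.
Proof. by move=> xi; rewrite /step -mulr_suml weight_sum1 mul1r. Qed.

Lemma nvm_step f xi : \sum_eta nvm P p xi eta * f eta = step f xi.
Proof.
have pick (g : config V) : \sum_eta (eta == g)%:R * f eta = f g.
  rewrite (bigD1 g) //= eqxx mul1r big1 ?addr0 // => eta /negPf ->.
  by rewrite mul0r.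
rewrite /nvm /step sum_moves.
under eq_bigr => eta _ do rewrite -mulrA.
rewrite -mulr_sumr mulr_sumr; under eq_bigr do rewrite mulr_suml mulr_sumr.
rewrite exchange_big /=; apply: eq_bigr => x _.
rewrite -mulr_sumr /weight /=.
under [X in _ = X + _]eq_bigr do rewrite -mulrA.
under [X in _ = _ + X]eq_bigr do rewrite -mulrA.
rewrite -!mulr_sumr -mulrDr; congr (_ * _).
under eq_bigr do rewrite mulrDl -!mulrA.
rewrite big_split /=; congr (_ + _).
  rewrite -mulr_sumr -mulrA; congr (_ * _); rewrite mulr_sumr.
  under eq_bigr do rewrite mulr_suml.
  rewrite exchange_big /=; apply: eq_bigr => b _.
  by under eq_bigr do rewrite -mulrA; rewrite -mulr_sumr pick.
under [X in _ = X]eq_bigr do rewrite -mulrA.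
rewrite -!mulr_sumr; congr (_ * _).
under eq_bigr do rewrite mulr_suml.
rewrite exchange_big /=; apply: eq_bigr => y _.
by under eq_bigr do rewrite -mulrA; rewrite -mulr_sumr pick.
Qed.

Lemma mean_step f : mean (step f) = mean f.
Proof.
have [_ _ wQ] := w_stat.
rewrite /mean; under eq_bigr do rewrite -nvm_step mulr_sumr.
rewrite exchange_big /=; apply: eq_bigr => eta _.
by under eq_bigr do rewrite mulrA; rewrite -mulr_suml wQ.
Qed.

Definition jump (i : V * (bool + V)) (xi : config V) : R := S (act i xi) - S xi.

Lemma jumpE i xi :
  jump i xi = pi i.1 * ((new_opinion xi i.2)%:R - (xi i.1)%:R).
Proof.
rewrite /jump /opinion_sum -sumrB (bigD1 i.1) //= big1 => [|z zi].
  by rewrite addr0 ffunE eqxx mulrBr.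
by rewrite ffunE (negPf zi) subrr.
Qed.

Lemma sum_pi_P (f : V -> R) :
  \sum_x pi x * \sum_y P x y * f y = \sum_y pi y * f y.
Proof.
have [_ _ piP] := pi_stat.
under eq_bigr do rewrite mulr_sumr.
rewrite exchange_big /=; apply: eq_bigr => y _.
by under eq_bigr do rewrite mulrA; rewrite -mulr_suml piP.
Qed.

(** Copying moves do not change [S] on average, because [pi] is stationary for
[P]; a coin flip pulls the opinion of its vertex towards [1/2]. *)
Lemma jump_drift xi : \sum_i weight i * jump i xi = p / n * (2^-1 - S xi).
Proof.
have [_ pi1 _] := pi_stat; have n0 := cardV_gt0.
rewrite sum_moves.
under eq_bigr => x _.
  rewrite big_bool /=.
  have -> : \sum_y weight (x, inr y) * jump (x, inr y) xi =
      n^-1 * (1 - p) * (pi x * (\sum_y P x y * (xi y)%:R) - pi x * (xi x)%:R).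
    transitivity (\sum_y n^-1 * (1 - p) * (pi x * (P x y * (xi y)%:R)
              - pi x * (xi x)%:R * P x y)).
      by apply: eq_bigr => y _; rewrite jumpE /weight /=; ring.
    by rewrite -mulr_sumr sumrB -!mulr_sumr P_sum mulr1.
  rewrite (_ : _ + _ = n^-1 * (1 - p) * (pi x * (\sum_y P x y * (xi y)%:R))
     + (n^-1 * p / 2 * pi x - n^-1 * (pi x * (xi x)%:R))); last first.
    by rewrite !jumpE /weight /=; field; rewrite gt_eqF.
  over.
rewrite big_split sumrB -!mulr_sumr sum_pi_P pi1 /= -/(S xi).
by field; rewrite gt_eqF.
Qed.

Lemma mean_opinion_sum : mean S = 2^-1.
Proof.
have /andP[p0 _] := p_range; have n0 := cardV_gt0.
have stepS xi : step S xi = S xi + p / n * (2^-1 - S xi).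
  rewrite -jump_drift -[X in X + _](step_cst (S xi) xi) /step -big_split /=.
  by apply: eq_bigr => i _; rewrite /jump; ring.
have := mean_step S; rewrite (eq_mean stepS) meanD meanZ meanB mean_cst.
move/eqP; rewrite -subr_eq0 addrAC subrr add0r mulf_eq0 subr_eq0.
by rewrite gt_eqF ?divr_gt0 //= => /eqP <-.
Qed.

(** The mean [1/2] of [S] is built in, by [mean_opinion_sum]. *)
Definition opinion_var : R := mean (fun xi => (S xi - 2^-1) ^+ 2).

(** The conditional second moment of the change of [S] in one step. *)
Definition sqr_jump (xi : config V) : R := \sum_i weight i * jump i xi ^+ 2.

(** In stationarity the variance lost to the drift is exactly compensated by
the squared jumps. *)
Lemma mean_sqr_jump : mean sqr_jump = 2 * (p / n) * opinion_var.
Proof.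
have stepS2 xi : step (fun xi => (S xi - 2^-1) ^+ 2) xi =
    (S xi - 2^-1) ^+ 2 - 2 * (p / n) * (S xi - 2^-1) ^+ 2 + sqr_jump xi.
  transitivity ((S xi - 2^-1) ^+ 2 * (\sum_i weight i) + sqr_jump xi
      + 2 * (S xi - 2^-1) * (\sum_i weight i * jump i xi)).
    rewrite /step /sqr_jump !mulr_sumr -!big_split /=.
    by apply: eq_bigr => i _; rewrite /jump; ring.
  by rewrite weight_sum1 jump_drift; ring.
have := mean_step (fun xi => (S xi - 2^-1) ^+ 2).
by rewrite (eq_mean stepS2) meanD meanB meanZ -/opinion_var; lra.
Qed.

Lemma sqr_jumpE xi : sqr_jump xi =
  \sum_x n^-1 * pi x ^+ 2 *
    (p / 2 + (1 - p) * \sum_y P x y * (xi x (+) xi y)%:R).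
Proof.
rewrite /sqr_jump sum_moves; apply: eq_bigr => x _.
rewrite mulrDr; congr (_ + _).
  by rewrite big_bool /= !jumpE /weight /=; case: (xi x) => /=; ring.
rewrite !mulr_sumr; apply: eq_bigr => y _.
by rewrite jumpE /weight /=; case: (xi x); case: (xi y) => /=; ring.
Qed.

(** Coin flips alone contribute [p / (2 * n) * \sum_x pi x ^+ 2] to the mean
square jump. *)
Lemma opinion_var_ge : (\sum_x pi x ^+ 2) / 4 <= opinion_var.
Proof.
have /andP[p0 p1] := p_range; have n0 := cardV_gt0.
have pn0 : 0 < p / n by rewrite divr_gt0.
suff : p / n * ((\sum_x pi x ^+ 2) / 2) <= mean sqr_jump.
  rewrite mean_sqr_jump.
  rewrite [leRHS](_ : _ = p / n * (2 * opinion_var)); last by ring.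
  by rewrite ler_pM2l //; lra.
rewrite -[leLHS]mean_cst; apply: le_mean => xi.
rewrite sqr_jumpE mulr_suml mulr_sumr; apply: ler_sum => x _.
rewrite [leLHS](_ : _ = n^-1 * pi x ^+ 2 * (p / 2)); last by ring.
apply: ler_wpM2l; first by rewrite mulr_ge0 ?invr_ge0 ?sqr_ge0 ?ltW.
rewrite lerDl mulr_ge0 ?subr_ge0 //.
by apply: sumr_ge0 => y _; rewrite mulr_ge0.
Qed.

Lemma sum_sqr_pi_gt0 : 0 < \sum_x pi x ^+ 2.
Proof.
have [pi0 pi1 _] := pi_stat.
have [z piz] : exists z, 0 < pi z.
  apply: contrapT => /forallNP pin; suff : \sum_x pi x = 0.
    by rewrite pi1 => /eqP; rewrite oner_eq0.
  by apply: big1 => x _; have := pi0 x; rewrite le0r => /predU1P[|/pin].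
rewrite (bigD1 z) //= ltr_pwDl ?exprn_gt0 //.
by apply: sumr_ge0 => x _; rewrite sqr_ge0.
Qed.

Lemma opinion_var_gt0 : 0 < opinion_var.
Proof.
by apply: lt_le_trans opinion_var_ge; rewrite divr_gt0 ?sum_sqr_pi_gt0.
Qed.

(** * Contraction and concentration *)

(** The Hamming distance weighted by [pi]: the weights make copying moves
neutral on average. *)
Definition dist (xi eta : config V) : R := \sum_x pi x * (xi x (+) eta x)%:R.

Lemma dist_le1 xi eta : dist xi eta <= 1.
Proof.
have [pi0 <- _] := pi_stat; apply: ler_sum => x _.
by rewrite ler_piMr // lern1 leq_b1.
Qed.

Lemma dist_act i xi eta : dist (act i xi) (act i eta) =
  dist xi eta - pi i.1 * (xi i.1 (+) eta i.1)%:R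
  + pi i.1 * (new_opinion xi i.2 (+) new_opinion eta i.2)%:R.
Proof.
rewrite /dist (bigD1 i.1) //= [in RHS](bigD1 i.1) //= !ffunE eqxx.
rewrite (eq_bigr (fun x => pi x * (xi x (+) eta x)%:R)); first by ring.
by move=> x xi1; rewrite !ffunE (negPf xi1).
Qed.

(** Under a common move, a discrepancy disappears from the updated vertex and
reappears only when a discrepant neighbour is copied; stationarity of [pi]
balances these two effects up to the coin flips. *)
Lemma dist_step xi eta :
  \sum_i weight i * dist (act i xi) (act i eta) = (1 - p / n) * dist xi eta.
Proof.
have n0 := cardV_gt0.
transitivity (dist xi eta * (\sum_i weight i) + \sum_i weight i * (pi i.1 *
    ((new_opinion xi i.2 (+) new_opinion eta i.2)%:R
     - (xi i.1 (+) eta i.1)%:R))).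
  rewrite mulr_sumr -big_split; apply: eq_bigr => i _ /=.
  by rewrite dist_act; ring.
rewrite weight_sum1 mulr1 sum_moves.
transitivity (dist xi eta + \sum_x (n^-1 * (1 - p) *
  (pi x * \sum_y P x y * (xi y (+) eta y)%:R)
  - n^-1 * (pi x * (xi x (+) eta x)%:R))); last first.
  by rewrite sumrB -!mulr_sumr sum_pi_P -/(dist xi eta); ring.
congr (_ + _); apply: eq_bigr => x _.
rewrite big_bool /=.
transitivity (- p * (n^-1 * (pi x * (xi x (+) eta x)%:R)) +
  (n^-1 * (1 - p) * (pi x * \sum_y P x y * (xi y (+) eta y)%:R) -
   n^-1 * (1 - p) * pi x * (xi x (+) eta x)%:R * \sum_y P x y)).
  congr (_ + _); first by rewrite /weight /=; field; rewrite gt_eqF.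
  rewrite !mulr_sumr -sumrB; apply: eq_bigr => y _.
  by rewrite /weight /=; ring.
by rewrite P_sum; ring.
Qed.

Lemma sqr_dist_act i xi : dist (act i xi) xi ^+ 2 = jump i xi ^+ 2.
Proof.
rewrite /dist (bigD1 i.1) //= big1 => [|x xi1]; last first.
  by rewrite ffunE (negPf xi1) addbb mulr0.
rewrite jumpE ffunE eqxx addr0.
by case: new_opinion; case: (xi i.1) => /=; ring.
Qed.

Definition lipschitz_dist (L : R) (F : config V -> R) : Prop :=
  forall xi eta, `|F xi - F eta| <= L * dist xi eta.

Lemma lipschitz_step L F :
  lipschitz_dist L F -> lipschitz_dist ((1 - p / n) * L) (step F).
Proof.
move=> LF xi eta; rewrite mulrAC -dist_step mulr_suml /step -sumrB.
apply: le_trans (ler_norm_sum _ _ _) _; apply: ler_sum => i _.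
rewrite -mulrBr normrM ger0_norm ?weight_ge0 // -[leRHS]mulrA.
by rewrite ler_wpM2l ?weight_ge0 // [leRHS]mulrC.
Qed.

Lemma sqr_mean_le_lipschitz L F : 0 <= L -> mean F = 0 ->
  lipschitz_dist L F -> mean (fun xi => F xi ^+ 2) <= L ^+ 2.
Proof.
move=> L0 F0 LF; rewrite -[leRHS]mean_cst; apply: le_mean => xi.
rewrite -(real_normK (num_real (F xi))) ler_sqr ?nnegrE //.
have -> : F xi = mean (fun eta => F xi - F eta).
  by rewrite meanB mean_cst F0 subr0.
apply: le_trans (norm_mean_le _) _; rewrite -[leRHS]mean_cst.
apply: le_mean => eta; apply: le_trans (LF _ _) _.
by rewrite ler_piMr // dist_le1.
Qed.

(** The variance of [F] after one step, given the present, is at most its mean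
square displacement, and a step moves the configuration by a distance equal to
the absolute change of [S]. *)
Lemma mean_sqr_step L F : lipschitz_dist L F ->
  mean (fun xi => F xi ^+ 2) <=
    mean (fun xi => step F xi ^+ 2) + L ^+ 2 * mean sqr_jump.
Proof.
move=> LF; rewrite -mean_step -meanZ -meanD; apply: le_mean => xi.
have le1 : \sum_i weight i * (F (act i xi) - F xi) ^+ 2 <= L ^+ 2 * sqr_jump xi.
  rewrite mulr_sumr; apply: ler_sum => i _.
  rewrite [leRHS]mulrCA ler_wpM2l ?weight_ge0 // -sqr_dist_act -exprMn.
  have jL := LF (act i xi) xi.
  rewrite -(real_normK (num_real (_ - _))) ler_sqr ?nnegrE //.
  exact: le_trans (normr_ge0 _) jL.
have : \sum_i weight i * (F (act i xi) - F xi) ^+ 2 =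
  step (fun eta => F eta ^+ 2) xi - 2 * F xi * step F xi
  + F xi ^+ 2 * \sum_i weight i.
  rewrite /step !mulr_sumr -sumrB -big_split.
  by apply: eq_bigr => i _ /=; ring.
rewrite weight_sum1 mulr1 => E.
have := sqr_ge0 (step F xi - F xi); rewrite sqrrB; lra.
Qed.

(** Iterating [mean_sqr_step] along [F], [step F], [step (step F)] and so on,
the Lipschitz constants shrink geometrically with ratio [r := 1 - p / n], and
the resulting series is bounded by [1 / (1 - r) = n / p]. *)
Lemma poincare L F : 0 <= L -> mean F = 0 -> lipschitz_dist L F ->
  mean (fun xi => F xi ^+ 2) <= L ^+ 2 * (n / p * mean sqr_jump).
Proof.
have /andP[p0 p1] := p_range; have n0 := cardV_gt0.
have n1 : 1 <= n by rewrite ler1n -(ltr0n R).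
set c := n / p * _ ; set r := 1 - p / n.
have pn1 : p / n <= 1 by rewrite ler_pdivrMr // mul1r (le_trans p1).
have r0 : 0 <= r by rewrite subr_ge0.
have r1 : r < 1 by rewrite gtrBl divr_gt0.
have j0 : 0 <= mean sqr_jump.
  rewrite -(mean_cst 0); apply: le_mean => xi; apply: sumr_ge0 => i _.
  by rewrite mulr_ge0 ?weight_ge0 ?sqr_ge0.
have c0 : 0 <= c by rewrite mulr_ge0 // divr_ge0 // ltW.
have jc : mean sqr_jump <= c * (1 - r ^+ 2).
  have -> : mean sqr_jump = c * (1 - r) by rewrite /c /r; field; lra.
  by rewrite ler_wpM2l // lerD2l lerN2 expr2 ler_piMl // ltW.
(* [c] absorbs the contribution of the [k] first steps, since
   [mean sqr_jump <= c * (1 - r ^+ 2)]; [r ^+ k] is the trivial bound for the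
   function reached after them. *)
have iter k : forall L F, 0 <= L -> mean F = 0 -> lipschitz_dist L F ->
    mean (fun xi => F xi ^+ 2) <= L ^+ 2 * (c + r ^+ k).
  elim: k => [|k IH] {}L {}F L0 F0 LF.
    apply: le_trans (sqr_mean_le_lipschitz L0 F0 LF) _.
    by rewrite ler_peMr ?sqr_ge0 // lerDr.
  have Q0 : mean (step F) = 0 by rewrite mean_step.
  have := IH _ _ (mulr_ge0 r0 L0) Q0 (lipschitz_step LF).
  have := mean_sqr_step LF; rewrite exprMn => h1 h2.
  apply: le_trans h1 _; apply: le_trans (lerD h2 (ler_wpM2l (sqr_ge0 L) jc)) _.
  rewrite -mulrA mulrCA -mulrDr ler_wpM2l ?sqr_ge0 //.
  have -> : r ^+ 2 * (c + r ^+ k) + c * (1 - r ^+ 2) = c + r * r ^+ k.+1.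
    by rewrite (exprS r k); ring.
  by rewrite lerD2l ler_piMl ?exprn_ge0 // ltW.
move=> L0 F0 LF.
have cv : L ^+ 2 * (c + r ^+ k) @[k --> \oo] --> L ^+ 2 * (c + 0).
  apply: cvgMr; apply: cvgD; first exact: cvg_cst.
  by apply: cvg_expr; rewrite ger0_norm.
rewrite -[c]addr0; apply: (ler_cvg_to (cvg_cst _) cv).
by apply: nearW => k; apply: iter.
Qed.

(** * Stein's method for the opinion sum *)

Definition standard_sum (xi : config V) : R :=
  (S xi - 2^-1) / Num.sqrt opinion_var.
Local Notation W := standard_sum.

Lemma mean_sqr_standard_sum : mean (fun xi => W xi ^+ 2) = 1.
Proof.
have v0 := opinion_var_gt0.
rewrite (eq_mean (g := fun xi => opinion_var^-1 * (S xi - 2^-1) ^+ 2)).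
  by rewrite meanZ mulVf // gt_eqF.
by move=> xi; rewrite /W expr_div_n sqr_sqrtr ?(ltW v0) // mulrC.
Qed.

Section Stein.
Context (m : R).
Hypothesis pi_le : forall x, pi x <= m.

Lemma pi_bound_ge0 : 0 <= m.
Proof.
have [pi0 _ _] := pi_stat; have := cardV_gt0; rewrite ltr0n.
by case/card_gt0P => x _; exact: le_trans (pi0 x) (pi_le x).
Qed.

(** Changing [xi] at [x] affects the term of [x], of weight [pi x ^+ 2], and
those of the vertices [y] that may copy [x], of total weight
[\sum_y pi y ^+ 2 * P y x <= m * pi x]. *)
Lemma lipschitz_sqr_jump : lipschitz_dist (2 * m / n) sqr_jump.
Proof.
have /andP[p0 p1] := p_range; have n0 := cardV_gt0; have [pi0 _ _] := pi_stat.
move=> xi eta; rewrite !sqr_jumpE -sumrB.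
apply: le_trans (ler_norm_sum _ _ _) _.
apply: (@le_trans _ _ (\sum_x m / n * (pi x * (xi x (+) eta x)%:R
   + pi x * \sum_y P x y * (xi y (+) eta y)%:R))); last first.
  rewrite -mulr_sumr big_split /= sum_pi_P -/(dist xi eta).
  by rewrite le_eqVlt; apply/orP; left; apply/eqP; ring.
apply: ler_sum => x _.
have -> : m / n * (pi x * (xi x (+) eta x)%:R
    + pi x * \sum_y P x y * (xi y (+) eta y)%:R) =
  n^-1 * (pi x * m) * (\sum_y P x y * ((xi x (+) eta x)%:R
    + (xi y (+) eta y)%:R)).
  under [in RHS]eq_bigr do rewrite mulrDr.
  by rewrite big_split /= -mulr_suml P_sum; ring.
rewrite -mulrBr (_ : _ - _ = (1 - p) * (\sum_y P x y * ((xi x (+) xi y)%:R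
    - (eta x (+) eta y)%:R))); last first.
  under [in RHS]eq_bigr do rewrite mulrBr.
  by rewrite sumrB; ring.
have q0 : 0 <= n^-1 * pi x ^+ 2 by rewrite mulr_ge0 ?sqr_ge0 // invr_ge0 ltW.
rewrite normrM (ger0_norm q0) ler_pM //.
  by rewrite expr2 !ler_wpM2l // invr_ge0 ltW.
rewrite normrM -[leRHS]mul1r ler_pM //; first by rewrite ger0_norm; lra.
apply: le_trans (ler_norm_sum _ _ _) _; apply: ler_sum => y _.
rewrite normrM ger0_norm // ler_wpM2l //.
by case: (xi x); case: (xi y); case: (eta x); case: (eta y);
  rewrite /= ?subrr ?sub0r ?subr0 ?normrN ?normr0 ?normr1; lra.
Qed.

Lemma mean_norm_sqr_jump : mean (fun xi => `|sqr_jump xi - mean sqr_jump|) <=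
  3 * (m / n) * Num.sqrt opinion_var.
Proof.
have /andP[p0 _] := p_range; have n0 := cardV_gt0.
have m0 : 0 <= m := pi_bound_ge0.
have v0 := ltW opinion_var_gt0.
have rhs0 : 0 <= 3 * (m / n) * Num.sqrt opinion_var.
  by rewrite !mulr_ge0 ?sqrtr_ge0 // invr_ge0 ltW.
rewrite -ler_sqr ?nnegrE //; last first.
  by rewrite -(mean_cst 0); apply: le_mean => xi.
apply: le_trans (sqr_mean_le _) _.
under eq_mean do rewrite real_normK ?num_real //.
have lipF : lipschitz_dist (2 * m / n) (fun xi => sqr_jump xi - mean sqr_jump).
  by move=> xi eta; rewrite opprB addrA subrK; apply: lipschitz_sqr_jump.
have F0 : mean (fun xi => sqr_jump xi - mean sqr_jump) = 0.
  by rewrite meanB mean_cst subrr.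
have L0 : 0 <= 2 * m / n by rewrite divr_ge0 ?mulr_ge0 // ltW.
apply: le_trans (poincare L0 F0 lipF) _.
rewrite mean_sqr_jump [leRHS]exprMn sqr_sqrtr //.
rewrite [leLHS](_ : _ = (8 * (m / n) ^+ 2) * opinion_var); last first.
  by field; rewrite !gt_eqF.
by rewrite [leRHS](_ : _ = 9 * (m / n) ^+ 2 * opinion_var) ?ler_wpM2r ?sqr_ge0
  ?ler_nat //; ring.
Qed.

(** Expand [E F(W') = E F(W)] to second order.  The first-order term is
[- (p / n) * E (W * f(W))] by [jump_drift]; replacing [sqr_jump] by its mean
in the second-order term gives [(p / n) * E (f2 (W))].  What remains is the
cubic remainder [rho] and the covariance [dev] of [f2 (W)] with [sqr_jump]. *)
Lemma stein_bound (F f f2 : R -> R) (C B : R) :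
  cubic_remainder C F f f2 ->
  (forall x, `|f2 x| <= B) ->
  `|mean (fun xi => f2 (W xi) - W xi * f (W xi))| <=
    C * (m / Num.sqrt opinion_var) ^+ 3 * (n / p)
    + 2 * B * (m / Num.sqrt opinion_var) / p.
Proof.
move=> taylor f2B; have v0 := opinion_var_gt0; set sd := Num.sqrt opinion_var.
have /andP[p0 p1] := p_range; have n0 := cardV_gt0; have [pi0 _ _] := pi_stat.
have pn0 : 0 < p / n by rewrite divr_gt0.
have sd0 : 0 < sd by rewrite sqrtr_gt0.
have sd2 : sd ^+ 2 = opinion_var by rewrite sqr_sqrtr // ltW.
have C0 : 0 <= C.
  apply: le_trans (normr_ge0 _) _.
  by have := taylor 0 1; rewrite subr0 normr1 !expr1n (mulr1 C); apply.
have B0 : 0 <= B by apply: le_trans (f2B 0).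
have m0 : 0 <= m := pi_bound_ge0.
pose rem i xi := F (W (act i xi)) - F (W xi) - f (W xi) * (jump i xi / sd)
   - f2 (W xi) * (jump i xi / sd) ^+ 2 / 2.
have rem_le i xi : `|rem i xi| <= C * (m / sd) ^+ 3.
  have dW : jump i xi / sd = W (act i xi) - W xi.
    by rewrite /W -/sd /jump; field; rewrite gt_eqF.
  rewrite /rem dW; apply: le_trans (taylor _ _) _.
  rewrite ler_wpM2l // lerXn2r ?nnegrE ?divr_ge0 ?(ltW sd0) // -dW.
  rewrite normrM normfV (gtr0_norm sd0) ler_wpM2r ?invr_ge0 ?(ltW sd0) //.
  rewrite jumpE normrM (ger0_norm (pi0 _)) -[leRHS]mulr1.
  apply: ler_pM => //.
  by case: new_opinion; case: (xi i.1) => /=;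
    rewrite ?subrr ?sub0r ?subr0 ?normrN ?normr0 ?normr1 ?ler01.
pose rho xi := \sum_i weight i * rem i xi.
have rho_le : `|mean rho| <= C * (m / sd) ^+ 3.
  apply: le_trans (norm_mean_le _) _; rewrite -[leRHS]mean_cst.
  apply: le_mean => xi; apply: le_trans (ler_norm_sum _ _ _) _.
  rewrite -[leRHS]mul1r -weight_sum1 mulr_suml; apply: ler_sum => i _.
  by rewrite normrM ger0_norm ?weight_ge0 // ler_wpM2l ?weight_ge0.
pose dev xi := f2 (W xi) * (sqr_jump xi - mean sqr_jump).
have dev_le : `|mean dev| <= B * (3 * (m / n) * sd).
  apply: le_trans (norm_mean_le _) _.
  apply: le_trans (ler_wpM2l B0 mean_norm_sqr_jump); rewrite -meanZ.
  by apply: le_mean => xi; rewrite normrM ler_wpM2r.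
have stepF xi : step (F \o W) xi = (F \o W) xi
    + (p / n * (f2 (W xi) - W xi * f (W xi))
       + ((2 * opinion_var)^-1 * dev xi + rho xi)).
  transitivity ((F \o W) xi * (\sum_i weight i)
    + (f (W xi) / sd * (\sum_i weight i * jump i xi)
    + (f2 (W xi) / (2 * sd ^+ 2) * sqr_jump xi + rho xi))).
    rewrite /step /sqr_jump /rho !mulr_sumr -!big_split /=.
    by apply: eq_bigr => i _; rewrite /rem; field; rewrite gt_eqF.
  rewrite weight_sum1 jump_drift sd2 /dev mean_sqr_jump /W -/sd -sd2.
  by field; rewrite !gt_eqF.
have E := mean_step (F \o W); rewrite (eq_mean stepF) !meanD !meanZ in E.
have {E} : mean (fun xi => f2 (W xi) - W xi * f (W xi)) =
   - ((n / p) * (mean rho + (2 * opinion_var)^-1 * mean dev)).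
  have : p / n * mean (fun xi => f2 (W xi) - W xi * f (W xi)) =
     - (mean rho + (2 * opinion_var)^-1 * mean dev) by lra.
  move=> E'; apply: (mulfI (lt0r_neq0 pn0)); rewrite E'.
  by field; rewrite !gt_eqF.
have np0 : 0 <= n / p by rewrite divr_ge0 // ltW.
move=> ->; rewrite normrN normrM (ger0_norm np0).
have vinv0 : 0 <= (2 * opinion_var)^-1 by rewrite invr_ge0 mulr_ge0 // ltW.
apply: (@le_trans _ _ (n / p * (C * (m / sd) ^+ 3
   + (2 * opinion_var)^-1 * (B * (3 * (m / n) * sd))))).
  apply: ler_wpM2l np0 _ _ _; apply: le_trans (ler_normD _ _) _.
  by rewrite lerD // normrM ger0_norm // ler_wpM2l.
rewrite -sd2 mulrDr [X in X + _]mulrC lerD2l.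
rewrite [leLHS](_ : _ = (3 / 2) * (B * (m / sd) / p)); last first.
  by field; rewrite !gt_eqF.
rewrite [leRHS](_ : _ = 2 * (B * (m / sd) / p)); last by ring.
rewrite ler_wpM2r //; last by lra.
by rewrite !mulr_ge0 // invr_ge0 ltW.
Qed.

(** Here [sd >= Num.sqrt (\sum_x pi x ^+ 2) / 2] by [opinion_var_ge].  For
[a := m / Num.sqrt (\sum_x pi x ^+ 2)], the bound
[\sum_x pi x ^+ 2 <= n * m ^+ 2] reads [1 <= a ^+ 2 * n], so that the term of
order [a / p] is dominated by [a ^+ 3 * (n / p)]. *)
Lemma stein_bound_ratio (F f f2 : R -> R) (C B : R) :
  cubic_remainder C F f f2 ->
  (forall x, `|f2 x| <= B) ->
  `|mean (fun xi => f2 (W xi) - W xi * f (W xi))| <=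
    (8 * C + 4 * B) * ((m / Num.sqrt (\sum_x pi x ^+ 2)) ^+ 3 * (n / p)).
Proof.
move=> taylor f2B; set sd := Num.sqrt opinion_var.
have /andP[p0 p1] := p_range; have n0 := cardV_gt0; have [pi0 _ _] := pi_stat.
have m0 : 0 <= m := pi_bound_ge0.
set N2 := \sum_x _; set N := Num.sqrt N2.
have N20 : 0 < N2 := sum_sqr_pi_gt0.
have N0 : 0 < N by rewrite sqrtr_gt0.
have v0 := opinion_var_gt0.
have sd0 : 0 < sd by rewrite sqrtr_gt0.
set a := m / N.
have a0 : 0 <= a by rewrite divr_ge0 // ltW.
have mN : m / sd <= 2 * a.
  have N20' : 0 < N / 2 by rewrite divr_gt0.
  have Nsd : N / 2 <= sd.
    rewrite -ler_sqr ?nnegrE ?(ltW sd0) ?(ltW N20') //.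
    rewrite expr_div_n !sqr_sqrtr ?(ltW N20) ?(ltW v0) //.
    by have := opinion_var_ge; rewrite -/N2; lra.
  rewrite [leRHS](_ : _ = m / (N / 2)); last first.
    by rewrite /a; field; rewrite gt_eqF.
  by rewrite ler_wpM2l // lef_pV2 ?posrE.
have a2n : 1 <= a ^+ 2 * n.
  rewrite /a exprMn exprVn sqr_sqrtr ?(ltW N20) // mulrAC.
  rewrite ler_pdivlMr // mul1r mulr_natr -sumr_const; apply: ler_sum => x _.
  by rewrite lerXn2r ?nnegrE.
have C0 : 0 <= C.
  apply: le_trans (normr_ge0 _) _.
  by have := taylor 0 1; rewrite subr0 normr1 !expr1n (mulr1 C); apply.
have B0 : 0 <= B by apply: le_trans (f2B 0).
apply: le_trans (stein_bound taylor f2B) _; rewrite -/sd [leRHS]mulrDl.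
have np0 : 0 <= n / p by rewrite divr_ge0 ?ltW.
apply: lerD.
  rewrite -mulrA -[leRHS]mulrA [leRHS](_ : _ = C * ((2 * a) ^+ 3 * (n / p)));
    last by ring.
  rewrite ler_wpM2l // ler_wpM2r // lerXn2r ?nnegrE //.
    by rewrite divr_ge0 // ltW.
  by rewrite mulr_ge0.
apply: (@le_trans _ _ (2 * B * (2 * a) / p)).
  by rewrite ler_wpM2r ?invr_ge0 ?(ltW p0) // ler_wpM2l // mulr_ge0.
rewrite [leLHS](_ : _ = 4 * B * (a / p)); last by ring.
rewrite ler_wpM2l ?mulr_ge0 // mulrA ler_wpM2r ?invr_ge0 ?(ltW p0) //.
by rewrite exprS -mulrA ler_peMr.
Qed.
End Stein.

End NoisyVoter.

(** * Expectations over the configuration space as finite sums *)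

Section FiniteProbability.
Context {R : realType} {V : finType} (G : probability (config V) R).

Definition mass (xi : config V) : R := fine (G [set xi]).

Lemma expectation_mean (f : config V -> R) : 'E_G[f]%E = (mean mass f)%:E.
Proof.
rewrite unlock.
have setTE : [set: config V] =
    \big[setU/set0]_(xi <- enum {: config V}) [set xi].
  apply/seteqP; split => // xi _; rewrite -bigcup_seq.
  by exists xi => //=; rewrite mem_enum.
rewrite setTE integral_bigsetU_EFin //.
- rewrite big_enum /= /mean -sumEFin; apply: eq_bigr => xi _.
  rewrite (eq_integral (cst (f xi)%:E)); last by move=> eta; rewrite inE => ->.
  by rewrite integral_cst // EFinM muleC /mass fineK ?fin_num_measure.
- exact: enum_uniq.
- apply/trivIsetP => xi eta _ _ /eqP ne.
  by apply/seteqP; split => // z [/= -> /ne].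
Qed.

Lemma probability_mean (A : set (config V)) :
  G A = (mean mass (\1_A))%:E.
Proof. by rewrite -expectation_mean expectation_indic. Qed.

End FiniteProbability.

Section StandardizedSum.
Context {R : realType} {V : finType} (P : V -> V -> R) (p : R) (pi : V -> R).
Context (G : probability (config V) R).
Hypothesis P_sum : forall x, \sum_y P x y = 1.
Hypothesis p_range : 0 < p <= 1.
Hypothesis pi_stat : stationary_distribution P pi.
Hypothesis G_stat : stationary_probability (nvm P p) G.

Lemma standardized_sumE : standardized_sum pi G = standard_sum pi (mass G).
Proof.
have mS := mean_opinion_sum P_sum p_range pi_stat G_stat.
apply/funext => xi; rewrite /standardized_sum /standard_sum /opinion_sd.
by rewrite /variance covariance.unlock !expectation_mean /= mS.
Qed.

Lemma cdf_standardized_sum t :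
  cdf (standardized_sum pi G : {RV G >-> R}) t =
  (mean (mass G) (fun xi => (standard_sum pi (mass G) xi <= t)%R%:R))%:E.
Proof.
rewrite /cdf /distribution /pushforward /= probability_mean; congr EFin.
apply: eq_mean => xi; rewrite indicE -standardized_sumE; congr _%:R.
by congr nat_of_bool; apply/idP/idP; rewrite inE /= in_itv.
Qed.

End StandardizedSum.

(** * The stationary distribution of the random walk on a graph *)

Section RandomWalk.
Context (R : realType) (V : finType) (e : rel V).
Hypothesis graph_e : connected_graph e.

Lemma random_walk_ge0 x y : 0 <= random_walk R e x y.
Proof. by rewrite /random_walk; case: ifP => // _; rewrite divr_ge0. Qed.

Lemma random_walk_sum x : \sum_y random_walk R e x y = 1.
Proof.
rewrite /random_walk; have [_|d0] := eqVneq (degree e x) 0%N.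
  rewrite (bigD1 x) //= big1 => [|y /negPf yx]; first by rewrite eqxx addr0.
  by rewrite eq_sym yx.
rewrite -mulr_suml -natr_sum (_ : (\sum_y e x y)%N = degree e x).
  by rewrite divff // pnatr_eq0.
rewrite /degree -sum1_card [RHS]big_mkcond /=.
by apply: eq_bigr => y _; rewrite unfold_in; case: (e x y).
Qed.

Hypothesis card_gt1 : (1 < #|V|)%N.

Lemma degree_gt0 x : (0 < degree e x)%N.
Proof.
have [_ _ econ] := graph_e.
have [y yx] : exists y, y != x.
  have /card_gt0P[y] : (0 < #|predC1 x|)%N.
    by rewrite cardC1 -ltnS prednK // ltnW.
  by rewrite !inE => yx; exists y.
have /connectP[[|z s] /=] := econ x y.
  by move=> _ /eqP; rewrite (negPf yx).
by case/andP=> xz _ _; apply/card_gt0P; exists z.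
Qed.

(** Stationarity says that [pi x / degree e x] is harmonic: at each vertex it is
the average of its values over the neighbours.  By the maximum principle it is
constant on a connected graph. *)
Lemma stationary_random_walk (pi : V -> R) :
  stationary_distribution (random_walk R e) pi ->
  exists2 c, 0 < c & forall x, pi x = c * (degree e x)%:R.
Proof.
have [esym _ econ] := graph_e => -[pi0 pi1 piP].
have d0 x : 0 < (degree e x)%:R :> R by rewrite ltr0n degree_gt0.
pose r x := pi x / (degree e x)%:R.
have rE x : pi x = r x * (degree e x)%:R by rewrite /r divfK // gt_eqF.
have harm y : \sum_(x | e y x) r x = r y * (degree e y)%:R.
  rewrite -rE -piP big_mkcond; apply: eq_bigr => x _.
  rewrite /random_walk gtn_eqF ?degree_gt0 // esym.
  by case: (e x y); rewrite ?mul1r ?mul0r ?mulr0.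
have [x0 _] : exists x : V, true.
  by have /card_gt0P[x _] := ltnW card_gt1; exists x.
pose x1 := [arg max_(x > x0) r x]%O.
have rmax x : r x <= r x1 by rewrite /x1; case: arg_maxP => // i _; apply.
have spread y z : r y = r x1 -> e y z -> r z = r x1.
  move=> ry yz; apply/eqP; rewrite eq_le rmax /= leNgt; apply/negP => lt.
  have : \sum_(x | e y x) r x < \sum_(x | e y x) r x1.
    rewrite (bigD1 z) //= [ltRHS](bigD1 z) //=; apply: ltr_leD => //.
    by apply: ler_sum => x _; exact: rmax.
  by rewrite harm ry sumr_const -[X in _ < X]mulr_natr ltxx.
have rc y : r y = r x1.
  have /connectP[s] := econ x1 y.
  elim/last_ind: s y => [|s z IH] y /=; first by move=> _ ->.
  rewrite rcons_path last_rcons => /andP[/IH h ez] ->.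
  by apply: spread ez; exact: h.
exists (r x1) => [|x]; last by rewrite rE rc.
rewrite lt_neqAle divr_ge0 // andbT eq_sym; apply/eqP => r0.
move: pi1; rewrite big1 => [/eqP|x _]; first by rewrite eq_sym oner_eq0.
by rewrite rE rc r0 mul0r.
Qed.

End RandomWalk.

(** * Convergence to the normal distribution *)

Theorem corollary4 (R : realType) (V : nat -> finType)
    (e : forall n, rel (V n)) (p : nat -> R)
    (pi : forall n, V n -> R)
    (Gamma : forall n, probability (config (V n)) R)
    (cardV : forall n, (0 < n)%N -> #|V n| = n)
    (graphe : forall n, (0 < n)%N -> connected_graph (e n))
    (p_range : forall n, (0 < n)%N -> 0 < p n <= 1)
    (p_noninc : forall m n, (0 < m)%N -> (m <= n)%N -> p n <= p m)
    (pi_stat : forall n, (0 < n)%N ->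
       stationary_distribution (@random_walk R (V n) (e n)) (pi n))
    (Gamma_stat : forall n, (0 < n)%N ->
       stationary_probability (nvm (@random_walk R (V n) (e n)) (p n))
         (Gamma n)) :
  ((\max_(x : V n) degree (e n) x)%N%:R
     / Num.sqrt (\sum_(x : V n) (degree (e n) x)%:R ^+ 2)) ^+ 3
    * (n%:R / p n) @[n --> \oo] --> (0 : R) ->
  cvg_in_distribution
    (fun n => standardized_sum (pi n) (Gamma n) : {RV (Gamma n) >-> R})
    (normal_prob 0 1).
Proof.
move=> ratio0 t _.
pose ratio n := ((\max_(x : V n) degree (e n) x)%N%:R
     / Num.sqrt (\sum_(x : V n) (degree (e n) x)%:R ^+ 2) : R) ^+ 3
    * (n%:R / p n).
pose X n := standard_sum (pi n) (mass (Gamma n)).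
have P_ge0 n := @random_walk_ge0 R (V n) (e n).
have P_sum n := @random_walk_sum R (V n) (e n).
have cv : mean (mass (Gamma n)) (fun xi => (X n xi <= t)%R%:R) @[n --> \oo] -->
    fine (normal_prob (0 : R) 1 [set` `]-oo, t]]).
  apply: (cdf_cvg_normal (w := fun n => mass (Gamma n)) (X := X)).
  - by move=> n n0 xi; have [G_ge0 _ _] := Gamma_stat n n0; exact: G_ge0.
  - by move=> n n0; have [_ G_sum1 _] := Gamma_stat n n0; exact: G_sum1.
  - move=> n n0; exact: mean_sqr_standard_sum (P_ge0 n) (P_sum n) (p_range n n0)
      (pi_stat n n0) (Gamma_stat n n0).
  move=> F f f2 C B taylor f2B; apply/cvgr0Pnorm_le => eps eps0.
  have Kratio0 : (8 * C + 4 * B) * ratio n @[n --> \oo] --> (8 * C + 4 * B) * 0.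
    by apply: cvgMr.
  rewrite mulr0 in Kratio0.
  have /cvgr0Pnorm_le/(_ _ eps0) near_eps := Kratio0.
  near=> n.
  have n1 : (1 < n)%N by near: n; exact: nbhs_infty_gt.
  have n0 := ltnW n1.
  have Kn : `|(8 * C + 4 * B) * ratio n| <= eps by near: n; exact: near_eps.
  have [c c0 piE] : exists2 c, 0 < c &
      forall x, pi n x = c * (degree (e n) x)%:R.
    apply: stationary_random_walk (pi_stat n n0); last by rewrite cardV.
    exact: graphe.
  set d := (\max_(x : V n) degree (e n) x)%N.
  have pi_le x : pi n x <= c * d%:R.
    by rewrite piE ler_pM2l // ler_nat; exact: leq_bigmax.
  have := stein_bound_ratio (P_ge0 n) (P_sum n) (p_range n n0) (pi_stat n n0)
    (Gamma_stat n n0) pi_le taylor f2B.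
  rewrite cardV //.
  have -> : c * d%:R / Num.sqrt (\sum_x pi n x ^+ 2) =
      d%:R / Num.sqrt (\sum_x (degree (e n) x)%:R ^+ 2).
    under eq_bigr do rewrite piE exprMn.
    rewrite -mulr_sumr sqrtrM ?sqr_ge0 // sqrtr_sqr gtr0_norm //.
    by rewrite invfM mulrACA divff ?mul1r // gt_eqF.
  by move=> bound; apply: le_trans bound _; apply: le_trans (ler_norm _) Kn.
have : (mean (mass (Gamma n)) (fun xi => (X n xi <= t)%R%:R))%:E
      @[n --> \oo] -->
    (fine (normal_prob (0 : R) 1 [set` `]-oo, t]]))%:E.
  by apply: cvg_EFin => //; apply: nearW.
rewrite fineK ?fin_num_measure //.
apply: cvg_trans; apply: near_eq_cvg; near=> n.
have n0 : (0 < n)%N by near: n; exact: nbhs_infty_gt.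
by rewrite (cdf_standardized_sum (P_sum n) (p_range n n0) (pi_stat n n0)
  (Gamma_stat n n0)).
Unshelve. all: by end_near.
Qed.
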